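(* Let $\Gamma=(X,R)$ be a bipartite distance-regular graph with diameter $D\ge4$ and valency $k\ge3$, and fix $x\in X$. Let $W$ be a thin irreducible $T(x)$-module with endpoint $2$ and local eigenvalue $\eta$, and let $W'$ be an irreducible $T(x)$-module. Then the following are equivalent: (i) $W$ and $W'$ are isomorphic as $T(x)$-modules; (ii) $W'$ is thin with endpoint $2$ and local eigenvalue $\eta$.
   Context: $\Gamma$ is a finite connected bipartite distance-regular graph with distance $\partial$; $A_i$ distance matrices, $A=A_1$. $E^*_i$ is the diagonal matrix with $(y,y)$-entry $1$ if $\partial(x,y)=i$, else $0$; $T(x)$ is the subalgebra of $\mathrm{Mat}_X(\mathbb{C})$ generated by $A,E^*_0,\dots,E^*_D$. $T$-modules are $T$-invariant subspaces of $\mathbb{C}^X$; an isomorphism of $T$-modules $W\to W'$ is a vector space isomorphism $\sigma$ with $(\sigma B-B\sigma)W=0$ for all $B\in T$. Thin: $\dim E^*_iW\le1$ for all $i$; endpoint $\min\{i:E^*_iW\ne0\}$; local eigenvalue of a thin irreducible $W$ with endpoint 2: the eigenvalue of $E^*_2A_2E^*_2$ on the one-dimensional space $E^*_2W$. *)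

(* Defs.v *)
From HB Require Import structures.
From mathcomp Require Import all_boot all_order all_algebra.
From mathcomp Require Import reals complex.

Set Implicit Arguments.
Unset Strict Implicit.
Unset Printing Implicit Defensive.

Import GRing.Theory.
Local Open Scope ring_scope.

Section Graph.
Variables (X : finType) (e : rel X).

Definition simple_graph : Prop := symmetric e /\ irreflexive e.

Definition connected_graph : Prop := forall y z : X, connect e y z.

Definition bipartite : Prop :=
  exists c : X -> bool, forall y z : X, e y z -> c y != c z.

Definition regular (k : nat) : Prop :=
  forall y : X, #|[set z | e y z]| = k.

Definition walk (n : nat) (y z : X) : bool :=
  [exists p : n.-tuple X, path e y p && (last y p == z)].

(* The least length of a walk from y to z. A shortest walk has length less
   than #|X|, so the value #|X| arises only when z is unreachable from y. *)
Definition dist (y z : X) : nat :=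
  find (fun n => walk n y z) (iota 0 #|X|).

Definition diameter : nat := \max_(y : X) \max_(z : X) dist y z.

Definition distance_regular : Prop :=
  connected_graph /\
  forall h i j : nat, (h <= diameter)%N -> (i <= diameter)%N ->
    (j <= diameter)%N ->
  exists p : nat, forall y z : X, dist y z = h ->
    #|[set w | (dist y w == i) && (dist w z == j)]| = p.

End Graph.

(* Mat_X(C) is 'M[C]_#|X| and C^X is the space of columns 'cV[C]_#|X|, the
   vertex carried by an index a being enum_val a; matrices act on the left. *)

Section Terwilliger.
Variables (C : fieldType) (X : finType) (e : rel X) (x : X).

Local Notation mat := 'M[C]_#|X|.
Local Notation vec := 'cV[C]_#|X|.

Definition distmx (i : nat) : mat :=
  \matrix_(a, b) (dist e (enum_val a) (enum_val b) == i)%:R.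

Definition dualidem (i : nat) : mat :=
  \matrix_(a, b) ((a == b) && (dist e x (enum_val a) == i))%:R.

Inductive terwilliger : mat -> Prop :=
| terwilliger_adj : terwilliger (distmx 1)
| terwilliger_dualidem (i : nat) :
    (i <= diameter e)%N -> terwilliger (dualidem i)
| terwilliger_one : terwilliger 1%:M
| terwilliger_add (B1 B2 : mat) :
    terwilliger B1 -> terwilliger B2 -> terwilliger (B1 + B2)
| terwilliger_scale (c : C) (B : mat) :
    terwilliger B -> terwilliger (c *: B)
| terwilliger_mul (B1 B2 : mat) :
    terwilliger B1 -> terwilliger B2 -> terwilliger (B1 *m B2).

Definition tmodule (W : {vspace vec}) : Prop :=
  forall B : mat, terwilliger B -> forall w : vec, w \in W -> B *m w \in W.

Definition tirreducible (W : {vspace vec}) : Prop :=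
  [/\ tmodule W, W <> 0%VS &
      forall U : {vspace vec},
        tmodule U -> (U <= W)%VS -> U = 0%VS \/ U = W].

(* As W is a T-module, vsproj W below is applied to vectors of W, on which it
   inverts the inclusion vsval. *)
Definition tisomorphic (W W' : {vspace vec}) : Prop :=
  exists sigma : 'Hom(subvs_of W, subvs_of W'),
    bijective sigma /\
    forall B : mat, terwilliger B -> forall w : subvs_of W,
      vsval (sigma (vsproj W (B *m vsval w))) = B *m vsval (sigma w).

(* E*_i W *)
Definition dualpart (i : nat) (W : {vspace vec}) : {vspace vec} :=
  (linfun (mulmx (dualidem i)) @: W)%VS.

Definition thin (W : {vspace vec}) : Prop :=
  forall i : nat, (i <= diameter e)%N -> (\dim (dualpart i W) <= 1)%N.

Definition endpoint (W : {vspace vec}) (r : nat) : Prop :=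
  [/\ (r <= diameter e)%N, dualpart r W <> 0%VS &
      forall i : nat, dualpart i W <> 0%VS -> (r <= i)%N].

(* Meant for thin W with endpoint 2, where E*_2 W is a line. *)
Definition local_eigenvalue (W : {vspace vec}) (eta : C) : Prop :=
  forall v : vec, v \in dualpart 2 W ->
    (dualidem 2 *m distmx 2 *m dualidem 2) *m v = eta *: v.

End Terwilliger.

(* Main.v *)
(* Write E*_i for the dual idempotents and let v span E*_2 W. Since E*_1 W = 0,
   the vectors w_m = E*_(m+2) A_m v span W, and A w_m is a combination of
   w_(m-1) and w_(m+1). Projecting A A_h v = b A_(h-1) v + c A_(h+1) v (the graph
   is bipartite, so there is no A_h term) onto the E*_j expresses the scalars in
   A w_m, and the scalars by which E*_(m+2) A_(m+2) v and E*_(m+2) A_(m+4) v are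
   multiples of w_m, recursively through the intersection numbers and the values
   at m = 0. The latter are eta and - 1 - eta, because
   E*_2 (A_0 + A_2 + A_4) v = E*_2 J v = 0. Hence W and W' have bases on which A
   and the E*_i act by the same matrices. *)
Require Import Defs.
From HB Require Import structures.
From mathcomp Require Import all_boot all_order all_algebra.
From mathcomp Require Import reals complex.

Set Implicit Arguments.
Unset Strict Implicit.
Unset Printing Implicit Defensive.

Import Order.TTheory GRing.Theory Num.Theory.
Local Open Scope ring_scope.

(** * Distance in a connected graph and its parity in a bipartite one *)

Section Distance.
Variables (X : finType) (e : rel X).
Hypothesis e_conn : connected_graph e.

Lemma walkP n (y z : X) :
  reflect (exists2 p, path e y p & size p = n /\ last y p = z) (walk e n y z).
Proof.
apply: (iffP existsP) => [[p /andP[yp /eqP pz]]|[p yp [sp pz]]].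
  by exists p => //; rewrite size_tuple.
by exists (tcast sp (in_tuple p)); rewrite val_tcast yp pz eqxx.
Qed.

Lemma walk_dist (y z : X) : walk e (dist e y z) y z.
Proof.
have hs : has (fun n => walk e n y z) (iota 0 #|X|).
  have /connectP[p yp ->] := e_conn y z.
  (* A walk without repeated vertices has fewer than [#|X|] edges, so the search range in [dist]
     contains its length. *)
  case/shortenP: yp => q yq uq _.
  apply/hasP; exists (size q); last by apply/walkP; exists q.
  by rewrite mem_iota /= add0n -[(size q).+1]/(size (y :: q)) -(card_uniqP uq) max_card.
have := nth_find 0%N hs; rewrite nth_iota //.
by move: hs; rewrite has_find size_iota.
Qed.

Lemma walk_dist_leq n (y z : X) : walk e n y z -> (dist e y z <= n)%N.
Proof.
move=> w; rewrite leqNgt; apply/negP => lt_n.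
have le_s : (dist e y z <= #|X|)%N by rewrite -(size_iota 0 #|X|) find_size.
have := before_find 0%N lt_n.
by rewrite nth_iota ?w // (leq_trans lt_n).
Qed.

Lemma dist_eq0 (y z : X) : (dist e y z == 0%N) = (y == z).
Proof.
apply/eqP/eqP => [d0|->].
  by have /walkP[p _] := walk_dist y z; rewrite d0 => -[/size0nil-> /= ->].
by apply/eqP; rewrite -leqn0 walk_dist_leq //; apply/walkP; exists [::].
Qed.

Lemma dist_triangle (y z w : X) : (dist e y w <= dist e y z + dist e z w)%N.
Proof.
have /walkP[p yp [sp pz]] := walk_dist y z.
have /walkP[q zq [sq qw]] := walk_dist z w.
apply: walk_dist_leq; apply/walkP; exists (p ++ q).
  by rewrite cat_path yp pz.
by rewrite size_cat sp sq last_cat pz qw.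
Qed.

Lemma distS (y z : X) h : dist e y z = h.+1 -> exists2 w, e y w & dist e w z = h.
Proof.
move=> dyz; have := walk_dist y z; rewrite dyz => /walkP[[|w p] /= + [//]].
move=> /andP[yw wp] [sp] pz; exists w => //; apply/eqP; rewrite eqn_leq.
rewrite walk_dist_leq /=; last by apply/walkP; exists p.
have := dist_triangle y w z; rewrite dyz => dle; rewrite -ltnS (leq_trans dle) //.
rewrite -add1n leq_add2r.
by apply: walk_dist_leq; apply/walkP; exists [:: w] => //=; rewrite yw.
Qed.

Lemma dist_leq_diameter (y z : X) : (dist e y z <= diameter e)%N.
Proof.
apply: leq_trans (leq_bigmax y); exact: (leq_bigmax (F := dist e y) z).
Qed.

Hypotheses (e_sym : symmetric e) (e_irr : irreflexive e).

Lemma dist_eq1 (y z : X) : (dist e y z == 1%N) = e y z.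
Proof.
apply/eqP/idP => [/distS[w yw /eqP]|yz]; first by rewrite dist_eq0 => /eqP<-.
apply/eqP; rewrite eqn_leq lt0n dist_eq0.
case: eqP => [eq_yz|_]; first by rewrite eq_yz e_irr in yz.
by rewrite andbT walk_dist_leq //; apply/walkP; exists [:: z]; rewrite //= yz.
Qed.

Lemma dist_sym (y z : X) : dist e y z = dist e z y.
Proof.
suff le y' z' : (dist e y' z' <= dist e z' y')%N by apply/eqP; rewrite eqn_leq !le.
move: {2}(dist e z' y') (erefl (dist e z' y')) => n.
elim: n z' => [|n IHn] z' /[dup] /= [/eqP|].
  by rewrite dist_eq0 => /eqP-> _; rewrite leqnn.
move=> dz /distS[w zw dw]; rewrite dz; apply: leq_trans (dist_triangle y' w z') _.
rewrite -addn1 leq_add -?dw ?IHn //.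
by rewrite leq_eqVlt dist_eq1 e_sym zw.
Qed.

Lemma dist_parity (c : X -> bool) : (forall y z, e y z -> c y != c z) ->
  forall y z, odd (dist e y z) = (c y != c z).
Proof.
move=> cP y z; move: {2}(dist e y z) (erefl (dist e y z)) => n.
elim: n y => [|n IHn] y.
  by move=> d0; rewrite d0; move/eqP: d0; rewrite dist_eq0 => /eqP->; rewrite eqxx.
move=> dyz; rewrite dyz; have [w /cP yw dw] := distS dyz.
by have := IHn _ dw; rewrite dw /= => ->; case: (c y) (c w) (c z) yw => [] [] [].
Qed.

Lemma dist_adj_leq (y z w : X) : dist e y w = 1%N ->
  (dist e y z <= (dist e w z).+1)%N.
Proof. by move=> yw; have := dist_triangle y w z; rewrite yw. Qed.

Hypothesis e_bip : bipartite e.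

(** Moving to a neighbour changes the distance by at most one, and the two-colouring flips its
    parity, which excludes equality. *)
Lemma dist_adj (y z w : X) : dist e y w = 1%N ->
  dist e w z = (dist e y z).+1 \/ dist e y z = (dist e w z).+1.
Proof.
move=> yw; have [c cP] := e_bip.
have wy : dist e w y = 1%N by rewrite dist_sym.
have := dist_adj_leq z yw; have := dist_adj_leq z wy.
have := dist_parity cP y z; have := dist_parity cP w z.
have : c y != c w by apply: cP; rewrite -dist_eq1 yw.
rewrite leq_eqVlt ltnS => ne p1 p2 /predU1P[->|le1]; first by left.
rewrite leq_eqVlt ltnS => /predU1P[->|le2]; first by right.
have eq_d : dist e w z = dist e y z by apply/eqP; rewrite eqn_leq le1 le2.
by move: p1 p2 ne; rewrite eq_d => ->; case: (c y) (c w) (c z) => [] [] [].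
Qed.

End Distance.

(** * The matrices A_i and E*_i: products, vanishing and the three-term recurrence *)

Section Matrices.
Variables (C : numClosedFieldType) (X : finType) (e : rel X) (x : X).

Local Notation mat := 'M[C]_#|X|.
Local Notation A i := (distmx C e i).
Local Notation Es i := (dualidem C e x i).
Local Notation T := (@terwilliger C X e x).

Lemma mul_dualidem_mx i p (M : 'M[C]_(#|X|, p)) :
  Es i *m M = \matrix_(a, b) ((dist e x (enum_val a) == i)%:R * M a b).
Proof.
have -> : Es i = diag_mx (\row_a (dist e x (enum_val a) == i)%:R).
  by apply/matrixP => a b; rewrite !mxE; case: eqP => [->|]; rewrite ?mulr1n ?mulr0n.
by rewrite mul_diag_mx; apply/matrixP => a b; rewrite !mxE.
Qed.

Lemma mul_mx_dualidem i p (M : 'M[C]_(p, #|X|)) :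
  M *m Es i = \matrix_(a, b) (M a b * (dist e x (enum_val b) == i)%:R).
Proof.
have -> : Es i = diag_mx (\row_a (dist e x (enum_val a) == i)%:R).
  by apply/matrixP => a b; rewrite !mxE; case: eqP => [->|]; rewrite ?mulr1n ?mulr0n.
by rewrite mul_mx_diag; apply/matrixP => a b; rewrite !mxE.
Qed.

Lemma mul_dualidem i j : Es i *m Es j = if i == j then Es i else 0.
Proof.
rewrite mul_dualidem_mx; apply/matrixP => a b; rewrite mxE [X in _ * X]mxE.
case: ifP => [/eqP <-|nij]; rewrite mxE; case: (a == b) => /=; rewrite ?mulr0 //.
  by case: eqP; rewrite ?mul0r ?mul1r.
by case: eqP => [->|]; rewrite ?mul0r // nij mulr0.
Qed.

Lemma dualidem_idem i : Es i *m Es i = Es i.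
Proof. by rewrite mul_dualidem eqxx. Qed.

Lemma dualidem_sandwich_eq0 i j (M : mat) :
  (forall a b, dist e x (enum_val a) = j -> dist e x (enum_val b) = i -> M a b = 0) ->
  Es j *m M *m Es i = 0.
Proof.
move=> M0; rewrite mul_dualidem_mx mul_mx_dualidem; apply/matrixP => a b.
rewrite !mxE; case: eqP => [da|]; last by rewrite !mul0r.
case: eqP => [db|]; last by rewrite mulr0.
by rewrite M0 // mulr0 mul0r.
Qed.

Lemma tr_dualidem i : (Es i)^T = Es i.
Proof. by apply/matrixP => a b; rewrite !mxE; case: (eqVneq a b) => [->|] /=. Qed.

Lemma map_conj_dualidem i : map_mx Num.conj (Es i) = Es i.
Proof. by apply/matrixP => a b; rewrite !mxE conjC_nat. Qed.

Lemma map_conj_distmx i : map_mx Num.conj (A i) = A i.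
Proof. by apply/matrixP => a b; rewrite !mxE conjC_nat. Qed.

(** The single entry of the product is the sum of the squared moduli of the entries of y. *)
Lemma conj_norm_eq0 (y : 'cV[C]_#|X|) : (map_mx Num.conj y)^T *m y = 0 -> y = 0.
Proof.
move=> /matrixP /(_ 0 0); rewrite !mxE => /eqP; rewrite psumr_eq0; last first.
  by move=> a _; rewrite !mxE mulrC mul_conjC_ge0.
move=> /allP y0; apply/matrixP => a b; rewrite mxE ord1.
have := y0 a (mem_index_enum a); rewrite !mxE mulrC mul_conjC_eq0 /=.
by move/eqP.
Qed.

Lemma terwilliger_zero : T 0.
Proof. by rewrite -(scale0r 1%:M); apply/terwilliger_scale/terwilliger_one. Qed.

Hypothesis e_dreg : distance_regular e.
Let e_conn : connected_graph e := e_dreg.1.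
Hypotheses (e_sym : symmetric e) (e_irr : irreflexive e) (e_bip : bipartite e).

Lemma dualidem_gt_diameter i : (diameter e < i)%N -> Es i = 0.
Proof.
move=> lt_i; apply/matrixP => a b; rewrite !mxE.
case: eqP => //= _; case: eqP => // da.
by move: lt_i; rewrite ltnNge -da dist_leq_diameter.
Qed.

Lemma terwilliger_dualidemT i : T (Es i).
Proof.
have [le_i|lt_i] := leqP i (diameter e); first exact: terwilliger_dualidem.
by rewrite dualidem_gt_diameter //; apply: terwilliger_zero.
Qed.

Lemma distmx0 : A 0 = 1%:M.
Proof.
by apply/matrixP => a b; rewrite !mxE dist_eq0 // (inj_eq enum_val_inj).
Qed.

Lemma tr_distmx i : (A i)^T = A i.
Proof. by apply/matrixP => a b; rewrite !mxE dist_sym. Qed.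

Lemma dualidem_distmx_far i h j : [|| (i + h < j)%N, (h + j < i)%N | (j + i < h)%N] ->
  Es j *m A h *m Es i = 0.
Proof.
move=> far; apply: dualidem_sandwich_eq0 => a b da db; rewrite mxE.
case: eqP => // dab; move: far; rewrite !ltnNge.
have := dist_triangle e_conn x (enum_val b) (enum_val a).
have := dist_triangle e_conn x (enum_val a) (enum_val b).
have := dist_triangle e_conn (enum_val a) x (enum_val b).
rewrite (dist_sym e_conn e_sym e_irr (enum_val b)).
rewrite (dist_sym e_conn e_sym e_irr (enum_val a) x) da db dab.
by rewrite (addnC h) => -> -> ->.
Qed.

(** By bipartiteness the neighbours of a vertex at distance i+1 from x lie at distance i or i+2, so
    A has no part within a level. *)
Lemma dualidem_adj i :
  Es i.+1 *m A 1 = Es i.+1 *m A 1 *m Es i + Es i.+1 *m A 1 *m Es i.+2.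
Proof.
rewrite mul_dualidem_mx !mul_mx_dualidem; apply/matrixP => a b; rewrite !mxE.
rewrite -mulrDr; case: eqP => [da|]; last by rewrite !mul0r.
case: eqP => [/(dist_adj e_conn e_sym e_irr e_bip x)|]; last by rewrite mulr0 mul0r.
rewrite (dist_sym e_conn e_sym e_irr _ x) (dist_sym e_conn e_sym e_irr _ x) da.
move=> [->|[->]]; first by rewrite eqxx gtn_eqF 1?ltnW // add0r !mulr1.
by rewrite eqxx ltn_eqF 1?ltnW // addr0 !mulr1.
Qed.

(** An entry of A A_(h+1) counts neighbours: it is the intersection number b_h at distance h,
    c_(h+2) at distance h+2, and zero otherwise because the graph is bipartite. Having c nonzero
    allows solving for A_(h+2). *)
Lemma distmx_recurrence h : exists b c : C,
  c != 0 /\ A 1 *m A h.+1 = b *: A h + c *: A h.+2.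
Proof.
have entry a b : (A 1 *m A h.+1) a b =
    #|[set w | (dist e (enum_val a) w == 1%N) && (dist e w (enum_val b) == h.+1)]|%:R.
  rewrite mxE -sum1_card natr_sum (reindex_onto enum_rank enum_val) /=; last first.
    by move=> i _; rewrite enum_valK.
  rewrite big_mkcond [RHS]big_mkcond /=; apply: eq_bigr => w _.
  by rewrite inE !mxE enum_rankK eqxx -natrM mulnb; case: (_ && _).
have [lt_D|le_D] := ltnP (diameter e) h.+1.
  have A0 n : (h < n)%N -> A n = 0.
    move=> lt_n; apply/matrixP => a b; rewrite !mxE.
    case: eqP => // dab; have := dist_leq_diameter e (enum_val a) (enum_val b).
    by rewrite dab leqNgt (leq_trans lt_D).
  (* Here A_(h+1) and A_(h+2) vanish, so c = 1 is an arbitrary nonzero choice. *)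
  exists 0, 1; split; first exact: oner_neq0.
  by rewrite (A0 h.+1) ?(A0 h.+2) ?mulmx0 ?scale0r ?scaler0 ?addr0.
have D1 : (1 <= diameter e)%N by apply: leq_trans le_D.
have [pb pbP] := e_dreg.2 h _ _ (ltnW le_D) D1 le_D.
have [c c0 cP] : exists2 c : C, c != 0 &
    forall a b, dist e (enum_val a) (enum_val b) = h.+2 -> (A 1 *m A h.+1) a b = c.
  have [/existsP[y /existsP[z /eqP yz]]|no] :=
      boolP [exists y, exists z, dist e y z == h.+2]; last first.
    (* With no pair at distance h+2 the condition on c is empty, and any nonzero value serves. *)
    exists 1; rewrite ?oner_neq0 // => a b dab; case/negP: no.
    by apply/existsP; exists (enum_val a); apply/existsP; exists (enum_val b); rewrite dab.
  have D2 : (h.+2 <= diameter e)%N by rewrite -yz dist_leq_diameter.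
  have [p pP] := e_dreg.2 _ _ _ D2 D1 le_D.
  exists p%:R => [|a b /pP]; last by rewrite entry => ->.
  (* The first step of a shortest path makes the count positive, and characteristic zero keeps it
     nonzero in [C]. *)
  rewrite pnatr_eq0 -lt0n -(pP _ _ yz) card_gt0; apply/set0Pn.
  have [w yw dw] := distS e_conn yz; exists w.
  by rewrite inE dw eqxx dist_eq1 // yw.
exists pb%:R, c; split => //; apply/matrixP => a b.
rewrite !mxE.
case: (eqVneq (dist e (enum_val a) (enum_val b)) h) => [dab|nh].
  have := entry a b; rewrite mxE => ->.
  by rewrite (pbP _ _ dab) dab ltn_eqF 1?ltnW // mulr1 mulr0 addr0.
case: (eqVneq (dist e (enum_val a) (enum_val b)) h.+2) => [dab|nh2].
  by have := cP _ _ dab; rewrite mxE => ->; rewrite mulr0 add0r mulr1.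
rewrite !mulr0 addr0; apply: big1 => w _; rewrite !mxE.
case: eqP => [aw|]; last by rewrite mul0r.
case: eqP => [wb|]; last by rewrite mulr0.
have := dist_adj e_conn e_sym e_irr e_bip (enum_val b) aw.
by rewrite wb => -[[/esym/eqP]|/eqP]; rewrite ?(negPf nh) ?(negPf nh2).
Qed.

(** Solve the recurrence for A_(h+2), carrying two consecutive indices through the induction. *)
Lemma terwilliger_distmx h : T (A h).
Proof.
suff [] : T (A h) /\ T (A h.+1) by [].
elim: h => [|h [Th Th1]].
  by split; [rewrite distmx0; apply: terwilliger_one | apply: terwilliger_adj].
split=> //; have [b [c [c0 rec]]] := distmx_recurrence h.
have -> : A h.+2 = c^-1 *: (A 1 *m A h.+1 + (- b) *: A h).
  by rewrite rec scaleNr addrAC subrr add0r scalerA mulVf ?scale1r.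
apply/terwilliger_scale/terwilliger_add; last exact: terwilliger_scale.
by apply: terwilliger_mul => //; apply: terwilliger_adj.
Qed.

(** A and the E*_i are real symmetric, so the squared norm of E*_j A u is the Hermitian product of u
    with E*_i A E*_j A u. This gives the nonvanishing of the lowering scalars below. *)
Lemma lower_raise_eq0 i j (u : 'cV[C]_#|X|) : Es i *m u = u ->
  Es i *m (A 1 *m (Es j *m (A 1 *m u))) = 0 -> Es j *m (A 1 *m u) = 0.
Proof.
move=> Eu LR0; apply: conj_norm_eq0; rewrite !map_mxM /= !trmx_mul.
rewrite map_conj_dualidem map_conj_distmx tr_dualidem tr_distmx.
rewrite -{1}Eu map_mxM /= trmx_mul map_conj_dualidem tr_dualidem -!mulmxA.
rewrite (mulmxA (Es j)) dualidem_idem.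
by rewrite LR0 mulmx0.
Qed.

End Matrices.

(** * Modules: thinness, transport along an isomorphism, and construction of isomorphisms *)

Section Modules.
Variables (C : numClosedFieldType) (X : finType) (e : rel X) (x : X).

Local Notation vec := 'cV[C]_#|X|.
Local Notation A i := (distmx C e i).
Local Notation Es i := (dualidem C e x i).
Local Notation T := (@terwilliger C X e x).

Implicit Types W : {vspace vec}.

Lemma dualpart_mem W i u : u \in W -> Es i *m u \in dualpart e x i W.
Proof. by move=> Wu; rewrite -[_ *m u]/(mulmx _ u) -lfunE memv_img. Qed.

Lemma dualpartP W i u : u \in dualpart e x i W -> Es i *m u = u.
Proof. by case/memv_imgP=> w _ ->; rewrite lfunE /= mulmxA dualidem_idem. Qed.

Lemma dualpart_sub W i : T (Es i) -> tmodule e x W -> (dualpart e x i W <= W)%VS.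
Proof.
by move=> Ti WT; apply/subvP => u /memv_imgP[w Ww ->]; rewrite lfunE; apply: WT.
Qed.

Lemma endpoint_dualpart0 W r i u :
  endpoint e x W r -> (i < r)%N -> u \in W -> Es i *m u = 0.
Proof.
case=> _ _ rmin lt_i /(dualpart_mem i).
have [->|/eqP/rmin] := eqVneq (dualpart e x i W) 0%VS; first by rewrite memv0 => /eqP.
by rewrite leqNgt lt_i.
Qed.

Lemma thin_line W i u w : thin e x W -> (i <= diameter e)%N ->
  u \in W -> w \in W -> Es i *m u != 0 -> exists a, Es i *m w = a *: (Es i *m u).
Proof.
move=> Wthin le_i Wu Ww nz; apply/vlineP.
suff -> : <[Es i *m u]>%VS = dualpart e x i W by apply: dualpart_mem.
apply/eqP; rewrite eqEdim -memvE dualpart_mem //= dim_vline nz.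
exact: Wthin.
Qed.

(** Composing with inclusion and projection turns the isomorphism into an endomorphism of the
    ambient space, where later arguments avoid subspace types. *)
Lemma tisomorphic_map W W' : tmodule e x W -> tmodule e x W' -> tisomorphic e x W W' ->
  exists f : 'End(vec), [/\ (f @: W)%VS = W', {in W &, injective f} &
    forall B, T B -> {in W, forall w, f (B *m w) = B *m f w}].
Proof.
move=> WT W'T [s [s_bij sT]].
pose f : 'End(vec) := (linfun (@vsval _ _ W') \o s \o linfun (vsproj W))%VF.
have fE u : f u = vsval (s (vsproj W u)) by rewrite !comp_lfunE !lfunE.
exists f; split.
- apply/vspaceP => u; apply/memv_imgP/idP => [[w _ ->]|W'u]; first by rewrite fE subvsP.
  have [g _ sK] := s_bij; exists (vsval (g (vsproj W' u))); first exact: subvsP.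
  by rewrite fE vsvalK sK vsprojK.
- move=> u w Wu Ww; rewrite !fE => /subvs_inj/(bij_inj s_bij) eq_uw.
  by rewrite -(vsprojK Wu) eq_uw vsprojK.
move=> B TB w Ww; rewrite !fE -sT // vsprojK //.
Qed.

Lemma dualpart_iso W W' (f : 'End(vec)) i : T (Es i) ->
  (f @: W)%VS = W' -> (forall B, T B -> {in W, forall w, f (B *m w) = B *m f w}) ->
  dualpart e x i W' = (f @: dualpart e x i W)%VS.
Proof.
move=> Ti <- fT; apply/vspaceP => u; apply/memv_imgP/memv_imgP.
  move=> [_ /memv_imgP[w Ww ->] ->]; exists (Es i *m w); first exact: dualpart_mem.
  by rewrite lfunE /= fT.
move=> [_ /memv_imgP[w Ww ->] ->]; exists (f w); first exact: memv_img.
by rewrite !lfunE /= fT.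
Qed.

(** This is (i) implies (ii): an isomorphism commutes with E*_i and with E*_2 A_2 E*_2, so it
    carries each E*_i W onto E*_i W' and preserves the eigenvalue. *)
Lemma tisomorphic_invariants W W' r eta : (forall i, T (Es i)) -> T (A 2) ->
  tmodule e x W -> tmodule e x W' -> tisomorphic e x W W' ->
  [/\ thin e x W, endpoint e x W r & local_eigenvalue e x W eta] ->
  [/\ thin e x W', endpoint e x W' r & local_eigenvalue e x W' eta].
Proof.
move=> TE TA2 WT W'T /(tisomorphic_map WT W'T)[f [fW f_inj fT]] [Wthin [le_r Wr rmin] Weta].
have EW' i := dualpart_iso (TE i) fW fT.
split.
- move=> i le_i; rewrite EW'; apply: leq_trans (Wthin i le_i).
  by rewrite -[leqRHS](limg_ker_dim f) leq_addl.
- split=> // [|i]; last first.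
    by rewrite EW' => nz; apply: rmin => i0; apply: nz; rewrite i0 limg0.
  rewrite EW' => W'0; apply: Wr; apply/eqP; rewrite -subv0; apply/subvP => u ru.
  have Wu := subvP (dualpart_sub (TE r) WT) _ ru.
  have : f u \in 0%VS by rewrite -W'0 memv_img.
  rewrite !memv0 => /eqP fu0; apply/eqP/f_inj; rewrite ?mem0v //.
  by rewrite fu0 linear0.
move=> _ /[!EW'] /memv_imgP[u u2 ->].
have Wu := subvP (dualpart_sub (TE 2) WT) _ u2.
rewrite -fT ?Weta ?linearZ //.
by do !apply: terwilliger_mul.
Qed.

(** The columns of [cokermx P] lie in the kernel of P, hence P' kills them, which puts the row space
    of P' inside that of P. *)
Lemma ker_factor n N (P P' : 'M[C]_(n, N)) :
  (forall q : 'cV_N, P *m q = 0 -> P' *m q = 0) -> exists Q : 'M_n, P' = Q *m P.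
Proof.
move=> kerP; apply/submxP; rewrite submxE; apply/eqP/matrixP => a b.
have /kerP : P *m (cokermx P *m delta_mx b 0) = 0 :> 'cV_n.
  by rewrite mulmxA mulmx_coker mul0mx.
by rewrite mulmxA -colE => /matrixP/(_ a 0); rewrite !mxE.
Qed.

(** The range of P is a nonzero T-invariant subspace of W, so irreducibility makes it all of W. *)
Lemma irreducible_range W N (P : 'M[C]_(#|X|, N)) : tirreducible e x W ->
  (forall m, col m P \in W) -> P != 0 ->
  (forall B, T B -> exists M : 'M_N, B *m P = P *m M) ->
  forall w, w \in W <-> exists q : 'cV_N, w = P *m q.
Proof.
move=> [WT _ Wmin] PW P0 PT.
pose U := limg (linfun (mulmx P) : 'Hom('cV[C]_N, vec)).
have UP w : w \in U <-> exists q : 'cV_N, w = P *m q.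
  split=> [/memv_imgP[q _ ->]|[q ->]]; first by exists q; rewrite lfunE.
  by rewrite -[_ *m q]/(mulmx P q) -lfunE memv_img ?memvf.
suff <- : U = W by [].
have [||U0|//] := Wmin U.
- move=> B TB w /UP[q ->]; apply/UP; have [M BP] := PT B TB.
  by exists (M *m q); rewrite (mulmxA B) BP -mulmxA.
- apply/subvP => w /UP[q ->].
  have -> : P *m q = \sum_m q m 0 *: col m P.
    apply/matrixP => a b; rewrite summxE !mxE; apply: eq_bigr => m _.
    by rewrite !mxE ord1 mulrC.
  by apply: memv_suml => m _; rewrite memvZ.
case/eqP: P0; apply/matrixP => a m.
have /eqP : col m P == 0.
  by rewrite -memv0 -U0; apply/UP; exists (delta_mx m 0); rewrite -colE.
by move/matrixP/(_ a 0); rewrite !mxE.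
Qed.

(** Equal kernels make P q -> P' q well defined and injective; it is left multiplication by some Q
    with P' = Q P. It commutes with each B because B acts on both families of columns through the
    same M. *)
Lemma tisomorphic_of_columns W W' N (P P' : 'M[C]_(#|X|, N)) :
  tirreducible e x W -> tirreducible e x W' ->
  (forall m, col m P \in W) -> (forall m, col m P' \in W') -> P != 0 -> P' != 0 ->
  (forall q : 'cV_N, P *m q = 0 <-> P' *m q = 0) ->
  (forall B, T B -> exists M : 'M_N, B *m P = P *m M /\ B *m P' = P' *m M) ->
  tisomorphic e x W W'.
Proof.
move=> Wirr W'irr PW PW' P0 P0' kerP PT.
have [Q PQ] := ker_factor (fun q => (kerP q).1).
have [Q' PQ'] := ker_factor (fun q => (kerP q).2).
have WP : forall w, w \in W <-> exists q : 'cV_N, w = P *m q.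
  by apply: irreducible_range => // B /PT[M [BP _]]; exists M.
have WP' : forall w, w \in W' <-> exists q : 'cV_N, w = P' *m q.
  by apply: irreducible_range => // B /PT[M [_ BP]]; exists M.
have QW w : w \in W -> Q *m w \in W'.
  by move/WP=> [q ->]; apply/WP'; exists q; rewrite mulmxA -PQ.
have QW' w : w \in W' -> Q' *m w \in W.
  by move/WP'=> [q ->]; apply/WP; exists q; rewrite mulmxA -PQ'.
have QK w : w \in W -> Q' *m (Q *m w) = w.
  by move/WP=> [q ->]; rewrite (mulmxA Q) -PQ mulmxA -PQ'.
have QK' w : w \in W' -> Q *m (Q' *m w) = w.
  by move/WP'=> [q ->]; rewrite (mulmxA Q') -PQ' mulmxA -PQ.
pose s : 'Hom(subvs_of W, subvs_of W') :=
  (linfun (vsproj W') \o (linfun (mulmx Q) : 'End(vec)) \o linfun (@vsval _ _ W))%VF.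
have sE w : vsval (s w) = Q *m vsval w.
  by rewrite !comp_lfunE !lfunE /= vsprojK // QW // subvsP.
exists s; split.
  exists (fun w => vsproj W (Q' *m vsval w)) => w; apply: subvs_inj.
    by rewrite sE QK ?vsprojK ?subvsP.
  by rewrite sE vsprojK ?QK' ?QW' ?subvsP.
move=> B TB w; rewrite !sE vsprojK; last by case: Wirr => WT _ _; apply/WT/subvsP.
have /WP[q ->] := subvsP w; have [M [BP BP']] := PT B TB.
by rewrite (mulmxA B) BP mulmxA mulmxA -PQ (mulmxA Q) -PQ (mulmxA B) BP'.
Qed.

End Modules.

(** * Endpoint two: the recursion run on both modules simultaneously *)

Section EndpointTwo.
Variables (C : numClosedFieldType) (X : finType) (e : rel X) (x : X).
Hypothesis e_dreg : distance_regular e.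
Hypotheses (e_sym : symmetric e) (e_irr : irreflexive e) (e_bip : bipartite e).
Let e_conn : connected_graph e := e_dreg.1.

Local Notation vec := 'cV[C]_#|X|.
Local Notation A i := (distmx C e i).
Local Notation Es i := (dualidem C e x i).
Local Notation T := (@terwilliger C X e x).

(** Two vertices at distance 2 from x are at distance 0, 2 or 4, so A_0 + A_2 + A_4 agrees with the
    all-ones matrix J between them, and J Y = 0. *)
Lemma endpoint2_dualidem_distmx4 p (Y : 'M[C]_(#|X|, p)) :
  Es 2 *m Y = Y -> Es 0 *m (A 2 *m Y) = 0 ->
  Es 2 *m (A 4 *m Y) = - (Y + Es 2 *m (A 2 *m Y)).
Proof.
move=> EY Y0; apply/eqP; rewrite -subr_eq0 opprK; apply/eqP.
pose J : 'M[C]_#|X| := const_mx 1.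
(* Row x of A_2 indicates the vertices at distance 2 from x, and E*_0 retains only that row. *)
have J0 : J *m Es 2 = J *m (Es 0 *m A 2).
  rewrite mul_mx_dualidem mul_dualidem_mx; apply/matrixP => a b; rewrite !mxE mul1r.
  rewrite (bigD1 (enum_rank x)) //= big1 => [|d ne_d].
    by rewrite !mxE enum_rankK dist_eq0 // eqxx !mul1r addr0.
  rewrite !mxE dist_eq0 // mul1r; case: eqP => [xd|]; last by rewrite mul0r.
  by rewrite xd enum_valK eqxx in ne_d.
have E024 : Es 2 *m (A 0 + A 2 + A 4) *m Es 2 = Es 2 *m J *m Es 2.
  apply/eqP; rewrite -subr_eq0 -mulmxBl -mulmxBr; apply/eqP.
  apply: dualidem_sandwich_eq0 => a b da db; rewrite !mxE -!natrD.
  have := dist_triangle e_conn (enum_val a) x (enum_val b).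
  rewrite (dist_sym e_conn e_sym e_irr _ x) da db.
  have [c cP] := e_bip.
  have := dist_parity e_conn cP x (enum_val b).
  have := dist_parity e_conn cP x (enum_val a).
  have := dist_parity e_conn cP (enum_val a) (enum_val b).
  rewrite da db => odd_ab /esym/negbFE/eqP xa /esym/negbFE/eqP xb.
  move: odd_ab; rewrite -xa -xb eqxx.
  by case: (dist _ _ _) => [|[|[|[|[|]]]]] //= _ _; rewrite ?subrr.
have := congr1 (mulmx^~ Y) E024; rewrite -!mulmxA EY.
rewrite -{2}EY (mulmxA J) J0 -!mulmxA Y0 !mulmx0 !mulmxDl !mulmxDr.
by rewrite distmx0 // mul1mx EY addrC.
Qed.

Variables (W W' : {vspace vec}) (eta : C) (v v' : vec).
Hypotheses (WT : tmodule e x W) (W'T : tmodule e x W').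
Hypotheses (Wthin : thin e x W) (W'thin : thin e x W').
Hypotheses (W2 : endpoint e x W 2) (W'2 : endpoint e x W' 2).
Hypotheses (Weta : local_eigenvalue e x W eta) (W'eta : local_eigenvalue e x W' eta).
Hypotheses (v2 : v \in dualpart e x 2 W) (v'2 : v' \in dualpart e x 2 W').
Hypotheses (v0 : v != 0) (v'0 : v' != 0).

(* Working with both vectors at once, as the columns of one matrix, forces the
   scalars below to be the same for W and W'. *)
Let Y : 'M[C]_(#|X|, 1 + 1) := row_mx v v'.
Let Ym m := Es m.+2 *m (A m *m Y).

Let TE i : T (Es i).
Proof. exact: terwilliger_dualidemT. Qed.
Let TA i : T (A i).
Proof. exact: terwilliger_distmx. Qed.

Let Wv : v \in W.
Proof. exact: (subvP (dualpart_sub (TE 2) WT)). Qed.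
Let W'v' : v' \in W'.
Proof. exact: (subvP (dualpart_sub (TE 2) W'T)). Qed.

Let EY : Es 2 *m Y = Y.
Proof. by rewrite mul_mx_row (dualpartP v2) (dualpartP v'2). Qed.

Let low i h : (i < 2)%N -> Es i *m (A h *m Y) = 0.
Proof.
move=> lt_i; rewrite !mul_mx_row (endpoint_dualpart0 W2) ?WT //.
by rewrite (endpoint_dualpart0 W'2) ?W'T // row_mx0.
Qed.

Let far j h : (h.+2 < j)%N || (j.+2 < h)%N -> Es j *m (A h *m Y) = 0.
Proof.
move=> far; rewrite -EY !mulmxA dualidem_distmx_far ?mul0mx //.
by case/orP: far; rewrite add2n addn2 => ->; rewrite ?orbT.
Qed.

Let recY h : exists b c : C, c != 0 /\
  forall j, Es j *m (A 1 *m (A h.+1 *m Y)) =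
    b *: (Es j *m (A h *m Y)) + c *: (Es j *m (A h.+2 *m Y)).
Proof.
have [b [c [c0 rec]]] := distmx_recurrence C e_dreg e_sym e_irr e_bip h.
exists b, c; split=> // j.
by rewrite (mulmxA (A 1)) rec mulmxDl mulmxDr -!scalemxAl -!scalemxAr.
Qed.

Let adj i p (Z : 'M[C]_(#|X|, p)) : Es i.+1 *m (A 1 *m Z) =
  Es i.+1 *m (A 1 *m (Es i *m Z)) + Es i.+1 *m (A 1 *m (Es i.+2 *m Z)).
Proof. by rewrite !mulmxA -mulmxDl -dualidem_adj. Qed.

(** E*_(m+4) A_m Y vanishes, so E*_(m+3) A sees only level m+2 of A_m Y; in the recurrence the lower
    term vanishes too, leaving the nonzero c. *)
Let raise m : exists2 c : C, c != 0 & Es m.+3 *m (A 1 *m Ym m) = c *: Ym m.+1.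
Proof.
have raiseA : Es m.+3 *m (A 1 *m (A m *m Y)) = Es m.+3 *m (A 1 *m Ym m).
  by rewrite adj (far (j := m.+4)) ?leqnSn // !mulmx0 addr0.
case: m raiseA => [|m] <-.
  by exists 1; rewrite ?oner_neq0 // scale1r distmx0 // mul1mx.
have [b [c [c0 ->]]] := recY m; exists c => //.
by rewrite far ?scaler0 ?add0r // ltnW.
Qed.

Let Ym_cols m : Ym m = row_mx (Es m.+2 *m (A m *m v)) (Es m.+2 *m (A m *m v')).
Proof. by rewrite /Ym !mul_mx_row. Qed.

(** The induction invariant, with scalars common to both columns. The last two clauses record what
    arrives at level m+2 from level m+1, the part to be subtracted when the recurrence is
    projected. *)
Let step_ok m := Ym m = 0 \/
  [/\ Es m.+2 *m (A m *m v) != 0, Es m.+2 *m (A m *m v') != 0,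
      exists al, Es m.+2 *m (A m.+2 *m Y) = al *: Ym m,
      exists be, Es m.+2 *m (A m.+4 *m Y) = be *: Ym m &
      (exists al, Es m.+2 *m (A 1 *m (Es m.+1 *m (A m.+1 *m Y))) = al *: Ym m) /\
      (exists be, Es m.+2 *m (A 1 *m (Es m.+1 *m (A m.+3 *m Y))) = be *: Ym m)].

Let step_ok0 : step_ok 0.
Proof.
have Y0E : Ym 0 = Y by rewrite /Ym distmx0 // mul1mx.
have E2A2 : Es 2 *m (A 2 *m Y) = eta *: Y.
  have EAE u W0 : u \in dualpart e x 2 W0 -> local_eigenvalue e x W0 eta ->
      Es 2 *m (A 2 *m u) = eta *: u.
    by move=> u2 /(_ u u2); rewrite -!mulmxA (dualpartP u2).
  by rewrite !mul_mx_row (EAE _ _ v2) // (EAE _ _ v'2) // scale_row_mx.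
right; rewrite !distmx0 // !mul1mx (dualpartP v2) (dualpartP v'2) Y0E; split=> //.
- by exists eta.
- exists (- (1 + eta)); rewrite endpoint2_dualidem_distmx4 ?E2A2 ?low //.
  by rewrite scaleNr scalerDl scale1r.
by rewrite !low // !mulmx0; split; exists 0; rewrite scale0r.
Qed.

(** Project A A_(m+1) Y onto level m+2: what does not come from level m+1 is the lowering of
    [Ym m.+1], whence the scalar b + c al - al'. *)
Let step_lower m : step_ok m -> exists y, Es m.+2 *m (A 1 *m Ym m.+1) = y *: Ym m.
Proof.
case=> [Ym0|[_ _ [al alE] _ [[al' al'E] _]]].
  exists 0; have [c c0] := raise m; rewrite Ym0 !mulmx0 => /esym/eqP.
  by rewrite scaler_eq0 (negPf c0) /= => /eqP->; rewrite !mulmx0 scale0r.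
have [b [c [_ /(_ m.+2)]]] := recY m; rewrite adj al'E alE => rec.
exists (b + c * al - al'); apply: (addrI (al' *: Ym m)).
by rewrite rec scalerBl addrCA subrr addr0 scalerDl scalerA.
Qed.

(* Thinness gives each column its own multiplier in E*_(m+3); applying
   E*_(m+2) A, which does not kill Ym m.+1, shows that both are s / y. *)
Let pin m h (y s : C) : step_ok m -> Ym m != 0 -> y != 0 -> (m.+3 <= diameter e)%N ->
  Es m.+2 *m (A 1 *m Ym m.+1) = y *: Ym m ->
  Es m.+2 *m (A 1 *m (Es m.+3 *m (A h *m Y))) = s *: Ym m ->
  exists a, Es m.+3 *m (A h *m Y) = a *: Ym m.+1.
Proof.
move=> ok nz y0 le_m lowE sE.
case: ok => [Ym0|[vm v'm _ _ _]]; first by rewrite Ym0 eqxx in nz.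
exists (s / y); rewrite Ym_cols scale_row_mx !mul_mx_row.
have colE u W0 : tmodule e x W0 -> thin e x W0 -> u \in W0 -> Es m.+2 *m (A m *m u) != 0 ->
    Es m.+2 *m (A 1 *m (Es m.+3 *m (A m.+1 *m u))) = y *: (Es m.+2 *m (A m *m u)) ->
    Es m.+2 *m (A 1 *m (Es m.+3 *m (A h *m u))) = s *: (Es m.+2 *m (A m *m u)) ->
    Es m.+3 *m (A h *m u) = s / y *: (Es m.+3 *m (A m.+1 *m u)).
  move=> W0T W0thin W0u um lowu su.
  have um1 : Es m.+3 *m (A m.+1 *m u) != 0.
    apply: contra_eq_neq lowu => ->; rewrite !mulmx0 eq_sym scaler_eq0.
    by rewrite (negPf y0) (negPf um).
  have [a aE] := thin_line W0thin le_m (W0T _ (TA m.+1) _ W0u) (W0T _ (TA h) _ W0u) um1.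
  rewrite aE; congr (_ *: _); apply: (mulIf y0); rewrite divfK //.
  move: su; rewrite aE -!scalemxAr lowu scalerA => /eqP.
  by rewrite -subr_eq0 -scalerBl scaler_eq0 (negPf um) orbF subr_eq0 => /eqP.
move: lowE sE; rewrite !Ym_cols !mul_mx_row !scale_row_mx.
move=> /eq_row_mx[lowE lowE'] /eq_row_mx[sE sE'].
by rewrite (colE v W) // (colE v' W').
Qed.

Let step_okS m : step_ok m -> step_ok m.+1.
Proof.
move=> ok; have [Ym0|nz] := eqVneq (Ym m.+1) 0; first by left.
have [c c0 raiseE] := raise m.
have nzm : Ym m != 0.
  apply: contraNneq nz => Ym0; move: raiseE; rewrite Ym0 !mulmx0 => /esym/eqP.
  by rewrite scaler_eq0 (negPf c0).
have le_m : (m.+3 <= diameter e)%N.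
  rewrite leqNgt; apply: contraNN nz => lt_m.
  by rewrite /Ym dualidem_gt_diameter // mul0mx.
have [y yE] := step_lower ok.
(* If y were 0, lowering would kill the raised columns; by positivity these would vanish, and so
   would [Ym m.+1]. *)
have y0 : y != 0.
  apply: contraNneq nz => y0; move: yE; rewrite y0 scale0r => LY0.
  suff : c *: Ym m.+1 = 0 by move/eqP; rewrite scaler_eq0 (negPf c0).
  have : Es m.+2 *m (A 1 *m (Es m.+3 *m (A 1 *m Ym m))) = 0.
    by rewrite raiseE -!scalemxAr LY0 scaler0.
  rewrite -raiseE Ym_cols !mul_mx_row -[0]row_mx0 => /eq_row_mx[v00 v'00].
  have LR (u : vec) : Es m.+2 *m (Es m.+2 *m u) = Es m.+2 *m u by rewrite mulmxA dualidem_idem.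
  have vR := lower_raise_eq0 e_dreg e_sym e_irr (LR _) v00.
  have v'R := lower_raise_eq0 e_dreg e_sym e_irr (LR _) v'00.
  by rewrite vR v'R.
case: (ok) => [Ym0|]; first by rewrite Ym0 eqxx in nzm.
move=> [vm v'm [al alE] [be beE] [_ [be' be'E]]].
right; split.
- move: yE; rewrite !Ym_cols !mul_mx_row !scale_row_mx => /eq_row_mx[/eqP yE _].
  apply: contraTneq yE => ->; rewrite !mulmx0 eq_sym scaler_eq0.
  by rewrite (negPf y0) (negPf vm).
- move: yE; rewrite !Ym_cols !mul_mx_row !scale_row_mx => /eq_row_mx[_ /eqP yE].
  apply: contraTneq yE => ->; rewrite !mulmx0 eq_sym scaler_eq0.
  by rewrite (negPf y0) (negPf v'm).
(* Project A A_(m+3) Y onto level m+2; removing the share be' from level m+1 leaves the part through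
   level m+3. *)
- have [b [d [_ /(_ m.+2)]]] := recY m.+2; rewrite adj be'E alE beE => rec.
  apply: (pin (s := b * al + d * be - be') ok nzm y0 le_m yE).
  apply: (addrI (be' *: Ym m)).
  by rewrite rec scalerBl addrCA subrr addr0 scalerDl !scalerA.
(* Project A A_(m+5) Y onto level m+2: the share from level m+1 and the A_(m+6) term both vanish by
   distance. *)
- have [b [d [_ /(_ m.+2)]]] := recY m.+4; rewrite adj (far (j := m.+1)) ?leqnSn ?orbT //.
  rewrite beE (far (j := m.+2)) ?leqnSn ?orbT // !mulmx0 add0r scaler0 addr0 scalerA => rec.
  exact: (pin ok nzm y0 le_m yE rec).
by rewrite alE beE -!scalemxAr raiseE !scalerA; split; eexists.
Qed.

(** The invariant gives both families of vectors w_m the same zeros and the same action of the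
    generators, so the column criterion applies. *)
Lemma tisomorphic_of_endpoint2 : tirreducible e x W -> tirreducible e x W' ->
  tisomorphic e x W W'.
Proof.
move=> Wirr W'irr.
have ok m : step_ok m by elim: m => [|m]; [apply: step_ok0 | apply: step_okS].
(* More columns than needed: those with m+2 beyond the diameter are zero, which does no harm. *)
pose N := (diameter e).+1.
pose P (u : vec) : 'M[C]_(#|X|, N) := \matrix_(a, m) (Es m.+2 *m (A m *m u)) a 0.
have colP u (m : 'I_N) : col m (P u) = Es m.+2 *m (A m *m u).
  by apply/matrixP => a b; rewrite !mxE ord1.
have P_neq0 (u : vec) : u != 0 -> Es 2 *m u = u -> P u != 0.
  move=> u0 Eu; apply: contraNneq u0 => /(congr1 (col ord0)).
  by rewrite colP col0 distmx0 // mul1mx Eu => ->.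
(* Distinct columns lie in distinct E*_j components, so a linear relation among them holds term by
   term and depends only on which columns vanish. *)
have kerP (u u' : vec) : (forall m, Es m.+2 *m (A m *m u) = 0 -> Es m.+2 *m (A m *m u') = 0) ->
    forall q : 'cV_N, P u *m q = 0 -> P u' *m q = 0.
  move=> uu' q Pq.
  have PqE w : P w *m q = \sum_m q m 0 *: (Es m.+2 *m (A m *m w)).
    apply/matrixP => a b; rewrite summxE !mxE; apply: eq_bigr => m _.
    by rewrite mxE ord1 mulrC [RHS]mxE.
  rewrite PqE big1 // => m _.
  have : Es m.+2 *m (P u *m q) = q m 0 *: (Es m.+2 *m (A m *m u)).
    rewrite PqE mulmx_sumr (bigD1 m) //= big1 => [|j ne_j].
      by rewrite addr0 -scalemxAr (mulmxA (Es _) (Es _)) dualidem_idem.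
    rewrite -scalemxAr (mulmxA (Es _) (Es _)) mul_dualidem !eqSS eq_sym.
    by rewrite (negPf (ne_j : (j != m :> nat))) mul0mx scaler0.
  rewrite Pq mulmx0 => /esym/eqP; rewrite scaler_eq0 => /orP[/eqP->|/eqP/uu'->].
    by rewrite scale0r.
  by rewrite scaler0.
have zeros m : Es m.+2 *m (A m *m v) = 0 <-> Es m.+2 *m (A m *m v') = 0.
  case: (ok m) => [|[vm v'm _ _ _]].
    by rewrite Ym_cols -[0]row_mx0 => /eq_row_mx[-> ->].
  by split=> /eqP; rewrite ?(negPf vm) ?(negPf v'm).
apply: (@tisomorphic_of_columns C X e x W W' N (P v) (P v')) => //.
- by move=> m; rewrite colP; do 2!apply: WT => //.
- by move=> m; rewrite colP; do 2!apply: W'T => //.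
- by rewrite P_neq0 // (dualpartP v2).
- by rewrite P_neq0 // (dualpartP v'2).
- by move=> q; split; apply: kerP => m /zeros.
(* Induction on the generation of B in T; only the generators A and E*_i need the recursion or the
   grading. *)
move=> B; elim=> {B} [|i le_i||B1 B2 _ [M1 [E1 E1']] _ [M2 [E2 E2']]|c B _ [M [E E']]
  |B1 B2 _ [M1 [E1 E1']] _ [M2 [E2 E2']]].
- have [q qP] : exists q : 'I_N -> 'cV[C]_N, forall m : 'I_N,
      A 1 *m (Es m.+2 *m (A m *m v)) = P v *m q m /\
      A 1 *m (Es m.+2 *m (A m *m v')) = P v' *m q m.
    have colq m : exists q : 'cV[C]_N,
        Ym m = row_mx (P v *m q) (P v' *m q).
      have [lt_m|le_m] := ltnP m N.
        by exists (delta_mx (Ordinal lt_m) 0); rewrite -!colE !colP Ym_cols //.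
      exists 0; rewrite !mulmx0 row_mx0 /Ym dualidem_gt_diameter ?mul0mx //.
      exact: leqW (leqW le_m).
    (* The transpose of [dualidem_adj]: A sends level m+2 into levels m+1 and m+3. *)
    have adjT m : A 1 *m Ym m = Es m.+1 *m (A 1 *m Ym m) + Es m.+3 *m (A 1 *m Ym m).
      have := congr1 trmx (dualidem_adj C x e_dreg e_sym e_irr e_bip m.+1).
      rewrite linearD /= !trmx_mul !tr_dualidem tr_distmx // => adjE.
      transitivity (A 1 *m Es m.+2 *m (A m *m Y)); first by rewrite -mulmxA.
      by rewrite adjE mulmxDl -!mulmxA.
    suff rowq m : exists q : 'cV[C]_N, A 1 *m Ym m = row_mx (P v *m q) (P v' *m q).
      have colAq (m : 'I_N) : exists q : 'cV[C]_N,
          A 1 *m (Es m.+2 *m (A m *m v)) = P v *m q /\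
          A 1 *m (Es m.+2 *m (A m *m v')) = P v' *m q.
        have [q] := rowq m; rewrite Ym_cols !mul_mx_row => /eq_row_mx[-> ->].
        by exists q.
      exact: fin_all_exists colAq.
    rewrite adjT; have [c _ ->] := raise m; have [q1 q1E] := colq m.+1.
    have [q2 q2E] : exists q : 'cV[C]_N,
        Es m.+1 *m (A 1 *m Ym m) = row_mx (P v *m q) (P v' *m q).
      case: m {q1 q1E} => [|m].
        exists 0; rewrite !mulmx0 row_mx0 /Ym distmx0 // mul1mx EY low //.
      have [y ->] := step_lower (ok m); have [q ->] := colq m.
      by exists (y *: q); rewrite scale_row_mx -!scalemxAr.
    exists (q2 + c *: q1); rewrite q1E q2E scale_row_mx add_row_mx.
    by rewrite !mulmxDr -!scalemxAr.
  have colM (u : vec) : (forall m : 'I_N, A 1 *m (Es m.+2 *m (A m *m u)) = P u *m q m) ->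
      A 1 *m P u = P u *m \matrix_(l, m) q m l 0.
    move=> uq; apply/matrixP => a m.
    have := uq m; rewrite -colP => /matrixP/(_ a 0); rewrite !mxE => LR.
    transitivity (\sum_j A 1 a j * col m (P u) j 0).
      by apply: eq_bigr => j _; rewrite !mxE.
    by rewrite LR; apply: eq_bigr => l _; rewrite !mxE.
  by exists (\matrix_(l, m) q m l 0); split; apply: colM => m; case: (qP m).
- have diagM (u : vec) : Es i *m P u = P u *m diag_mx (\row_m (i == m.+2)%:R).
    rewrite mul_mx_diag; apply/matrixP => a m.
    transitivity ((Es i *m col m (P u)) a 0).
      by rewrite !mxE; apply: eq_bigr => j _; rewrite !mxE.
    rewrite colP mulmxA mul_dualidem ![in RHS]mxE.
    case: eqP => [->|_] /=; last by rewrite mul0mx mxE mulr0.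
    by rewrite mulr1 [LHS]mxE.
  by exists (diag_mx (\row_(m < N) (i == m.+2)%:R)).
- by exists 1%:M; rewrite !mul1mx !mulmx1.
- by exists (M1 + M2); rewrite !mulmxDl !mulmxDr E1 E1' E2 E2'.
- by exists (c *: M); rewrite -!scalemxAl -!scalemxAr E E'.
by exists (M1 *m M2); rewrite -!mulmxA E2 E2' !mulmxA E1 E1'.
Qed.

End EndpointTwo.

Theorem theorem17p1 (R : realType) (X : finType) (e : rel X) (D k : nat)
    (x : X) (W W' : {vspace 'cV[R[i]]_#|X|}) (eta : R[i]) :
  simple_graph e -> bipartite e -> distance_regular e ->
  diameter e = D -> (4 <= D)%N ->
  regular e k -> (3 <= k)%N ->
  tirreducible e x W -> thin e x W -> endpoint e x W 2 ->
  local_eigenvalue e x W eta ->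
  tirreducible e x W' ->
  (tisomorphic e x W W' <->
   [/\ thin e x W', endpoint e x W' 2 & local_eigenvalue e x W' eta]).

Proof.
move=> [e_sym e_irr] e_bip e_dreg _ _ _ _ Wirr Wthin W2 Weta W'irr.
have [[WT _ _] [W'T _ _]] := (Wirr, W'irr).
have TE i := @terwilliger_dualidemT R[i] X e x i.
have TA2 := terwilliger_distmx R[i] x e_dreg e_sym e_irr e_bip 2.
split=> [WW'|[W'thin W'2 W'eta]]; first exact: (tisomorphic_invariants TE TA2 WT W'T WW').
(* The endpoint condition makes E*_2 U nonzero, so [vpick] supplies the starting vectors v and
   v'. *)
have pick (U : {vspace 'cV[R[i]]_#|X|}) : endpoint e x U 2 -> vpick (dualpart e x 2 U) != 0.
  by case=> _ /eqP nz _; rewrite vpick0.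
exact: (tisomorphic_of_endpoint2 e_dreg e_sym e_irr e_bip WT W'T Wthin W'thin W2 W'2
  Weta W'eta (memv_pick _) (memv_pick _) (pick _ W2) (pick _ W'2) Wirr W'irr).
Qed.
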